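(* Let $(V,\mathcal{K})$ be a finite simplicial complex and $f:\mathcal{K}\to\mathbb{R}$ an injective discrete Morse function. Then the discrete Morse vector $(n_0,n_1,\dots,n_d)$ of $f$, where $n_i$ is the number of critical simplices of $f$ of dimension $i$, coincides with the continuous Morse vector of $f^L|_{|S_\mathcal{K}|}$, whose $i$-th entry is the number of critical points of $f^L|_{|S_\mathcal{K}|}$ of index $i$.
   Context: $V=\{1,\dots,n\}$, $\mathcal{K}$ the set of nonempty faces, containing all singletons, $\mathcal{K}\ne\mathcal{P}(V)$. Order complex $S_\mathcal{K}$: simplices are chains in $\mathcal{K}$; $|S_\mathcal{K}|=\bigcup_{\text{chains }\mathcal{C}}\mathrm{conv}(\vec1_\sigma:\sigma\in\mathcal{C})\subset\mathbb{R}^V$. For $\vec x=\sum\lambda_i\vec1_{\sigma_i}$ on a chain simplex, the Lovász extension is $f^L(\vec x)=\sum\lambda_if(\sigma_i)$. Discrete Morse function: for each $p$-simplex $\sigma$, $\#\{\tau\supset\sigma:\dim\tau=p+1,f(\tau)\le f(\sigma)\}\le1$ and $\#\{\nu\subset\sigma:\dim\nu=p-1,f(\nu)\ge f(\sigma)\}\le1$; $\sigma$ critical if both sets empty. Critical points of the PL function $f^L|_{|S_\mathcal{K}|}$ and their indices are taken in the PL sense of Kühnel (a vertex $v$ is critical of index $i$ if the relative Betti number $\beta_i(\overline{\mathrm{star}_-(v)},\mathrm{link}_-(v))\neq 0$, where $\mathrm{star}_-(v),\mathrm{link}_-(v)$ are the parts of the star and link of $v$ where the function is $\le$ its value at $v$),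 equivalently in the metric (weak slope) or topological sense with index given by nonvanishing critical groups. *)

(* Defs.v *)
From HB Require Import structures.
From mathcomp Require Import finmap boolp classical_sets functions cardinality.
From mathcomp Require Import reals.
(* Last, so that set0, setT, ... are those of finset. *)
From mathcomp Require Import all_boot all_order all_algebra.

Set Implicit Arguments.
Unset Strict Implicit.
Unset Printing Implicit Defensive.

Import Order.TTheory GRing.Theory Num.Theory.
Local Open Scope ring_scope.

(** * Finite simplicial complexes, represented by their nonempty faces *)

Section Complexes.
Variable T : finType.
Implicit Types (K : {set {set T}}) (s t : {set T}).

(* Every point of T is required to be a vertex. *)
Definition simplicial_complex K : Prop :=
  [/\ set0 \notin K,
      forall s t, s \in K -> t \subset s -> t != set0 -> t \in K
    & forall v : T, [set v]%SET \in K].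

Definition dimension K : nat := (\max_(s in K) #|s|).-1.

(* The smallest complex containing a set of simplices. *)
Definition face_closure K : {set {set T}} :=
  [set t | (t != set0) && [exists s in K, t \subset s]]%SET.

Definition star K (v : T) : {set {set T}} := [set s in K | v \in s]%SET.

Definition link K (v : T) : {set {set T}} :=
  [set t in K | (v \notin t) && ((v |: t)%SET \in K)]%SET.

End Complexes.

(** * Relative simplicial homology with coefficients in a field *)

Section Homology.
Variables (F : fieldType) (T : finType).
Implicit Types (X A : {set {set T}}) (s t : {set T}).

Definition chain := {ffun {set T} -> F^o}.

Definition simplex_chain s : chain := [ffun t => (t == s)%:R].

(* The i-chains of X. *)
Definition chain_space X (i : nat) : {vspace chain} :=
  <<[seq simplex_chain s | s <- enum X & #|s| == i.+1]>>%VS.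

(* Simplices are oriented by the enumeration of T.  The empty set is not a
   simplex, so the boundary of a vertex is 0 (homology is not reduced). *)
Definition incidence s t : F :=
  if t == set0 then 0 else
  \sum_(v in s | t == (s :\ v)%SET)
    (-1) ^+ #|[set w in s | (enum_rank w < enum_rank v)%N]%SET|.

Definition boundary_fun (c : chain) : chain :=
  [ffun t => \sum_s c s * incidence s t].

Fact boundary_fun_is_linear : linear boundary_fun.
Proof.
move=> a b c; apply/ffunP => t; rewrite !ffunE /= scaler_sumr -big_split /=.
by apply: eq_bigr => s _; rewrite !ffunE mulrDl -scalerAl.
Qed.

HB.instance Definition _ :=
  GRing.isLinear.Build F chain chain _ boundary_fun boundary_fun_is_linear.

Definition boundary : 'End(chain) := linfun boundary_fun.

(* For i = 0 the preimage is everything on 0-chains, whose boundary is 0, so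
   the value of i.-1 is immaterial. *)
Definition relative_cycles X A (i : nat) : {vspace chain} :=
  (chain_space X i :&: boundary @^-1: chain_space A i.-1)%VS.

Definition relative_boundaries X A (i : nat) : {vspace chain} :=
  (boundary @: chain_space X i.+1 + chain_space A i)%VS.

(* dim H_i(X, A; F), for a subcomplex A of X: the boundaries are then cycles,
   so the subtraction does not truncate. *)
Definition betti X A (i : nat) : nat :=
  (\dim (relative_cycles X A i) - \dim (relative_boundaries X A i))%N.

End Homology.

(** * Critical points of functions on a geometric simplicial complex *)

Section PLCritical.
Variables (R : realType) (F : fieldType) (T : finType) (E : lmodType R).
(* The abstract complex S is placed in E by the position p of its vertices. *)
Variables (S : {set {set T}}) (p : T -> E) (g : E -> R).

Definition barycentric_weights (s : {set T}) (lam : T -> R) : Prop :=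
  (forall v, v \in s -> 0 <= lam v) /\ \sum_(v in s) lam v = 1.

Definition convex_hull (s : {set T}) : set E :=
  [set x | exists2 lam, barycentric_weights s lam
                      & x = \sum_(v in s) lam v *: p v]%classic.

Definition realization : set E :=
  [set x | exists2 s, s \in S & convex_hull s x]%classic.

Definition below (v : T) (s : {set T}) : Prop :=
  forall x, convex_hull s x -> g x <= g (p v).

Definition lower_star (v : T) : {set {set T}} :=
  [set s in star S v | `[< below v s >]]%SET.

Definition lower_link (v : T) : {set {set T}} :=
  [set s in link S v | `[< below v s >]]%SET.

(* The critical points of index i of g restricted to the realization, in the
   sense of Kuehnel; g is meant to be affine on each simplex and to separate
   adjacent vertices. *)
Definition critical_points (i : nat) : set E :=
  [set x | realization x /\
     exists v, [/\ [set v]%SET \in S, x = p v &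
       betti F (face_closure (lower_star v)) (lower_link v) i != 0%N]]%classic.

Lemma finite_critical_points i : finite_set (critical_points i).
Proof.
apply: (@sub_finite_set _ _ [set` [fset p v | v in T]%fset]).
  by move=> x [_ [v [_ -> _]]] /=; apply/imfsetP; exists v.
exact: finite_fset.
Qed.

Definition continuous_morse_vector : seq nat :=
  mkseq (fun i => #|` fset_set (critical_points i)|) (dimension S).+1.

End PLCritical.

(** * Discrete Morse functions *)

Section DiscreteMorse.
Variables (R : realType) (T : finType).
Variables (K : {set {set T}}) (f : {set T} -> R).
Implicit Types s : {set T}.

Definition upper_exceptions s : {set {set T}} :=
  [set t in K | [&& s \subset t, #|t| == #|s|.+1 & f t <= f s]]%SET.

Definition lower_exceptions s : {set {set T}} :=
  [set t in K | [&& t \subset s, #|s| == #|t|.+1 & f s <= f t]]%SET.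

Definition discrete_morse : Prop :=
  forall s, s \in K ->
    (#|upper_exceptions s| <= 1)%N /\ (#|lower_exceptions s| <= 1)%N.

Definition critical_simplices (i : nat) : {set {set T}} :=
  [set s in K | [&& #|s| == i.+1, upper_exceptions s == set0
                  & lower_exceptions s == set0]]%SET.

Definition discrete_morse_vector : seq nat :=
  mkseq (fun i => #|critical_simplices i|) (dimension K).+1.

End DiscreteMorse.

(** * The order complex and the Lovasz extension *)

Section Lovasz.
Variables (R : realType) (n : nat).
Variable K : {set {set 'I_n}}.
Implicit Types (C : {set {set 'I_n}}) (s t : {set 'I_n}).

Definition is_chain C : bool :=
  [forall s in C, forall t in C, (s \subset t) || (t \subset s)].

(* The simplices are the nonempty chains of K, so the vertices are the sets
   [set s] with s in K. *)
Definition order_complex : {set {set {set 'I_n}}} :=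
  [set C | [&& C != set0, C \subset K & is_chain C]]%SET.

Definition indicator s : 'rV[R]_n := \row_i (i \in s)%:R.

(* The value at x is characterized by lovaszE below; it is 0 off the
   realization of the order complex. *)
Definition lovasz (f : {set 'I_n} -> R) (x : 'rV[R]_n) : R :=
  xget 0 [set y | exists C lam,
    [/\ C \in order_complex, barycentric_weights C lam,
        x = \sum_(s in C) lam s *: indicator s
      & y = \sum_(s in C) lam s * f s]]%classic.

Let ext C (lam : {set 'I_n} -> R) s := if s \in C then lam s else 0.

Let up_sum (l : {set 'I_n} -> R) s := \sum_(t : {set 'I_n} | s \subset t) l t.

Let up_sum_min C lam s : C \in order_complex -> barycentric_weights C lam ->
  s != set0 ->
  let x := \sum_(t in C) lam t *: indicator t in
  (forall i, i \in s -> up_sum (ext C lam) s <= x 0 i) /\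
  (exists2 i, i \in s & up_sum (ext C lam) s = x 0 i).
Proof.
rewrite inE => /and3P[_ _ /forall_inP chC] [lam0 _] s0 x.
have xE i : x 0 i = \sum_(t : {set 'I_n} | i \in t) ext C lam t.
  rewrite /x summxE big_mkcond [RHS]big_mkcond /=; apply: eq_bigr => t _.
  rewrite !mxE /ext; case: (t \in C) (i \in t) => [] [];
    by rewrite ?mulr1 ?mulr0.
have e0 t : 0 <= ext C lam t by rewrite /ext; case: ifP => // /lam0.
split=> [i si|].
  rewrite xE /up_sum big_mkcond [leRHS]big_mkcond /=; apply: ler_sum => t _.
  by case: ifP => [/subsetP/(_ _ si)->//|_]; case: ifP.
have [i si iP] : exists2 i, i \in s &
    forall t, t \in C -> i \in t -> s \subset t.
  have [C0|[t0 t0P]] := set_0Vmem [set t in C | ~~ (s \subset t)]%SET.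
    have /set0Pn[i si] := s0; exists i => // t tC _.
    by apply: contraT => st; have := in_set0 t; rewrite -C0 inE tC st.
  have [m] := @arg_maxnP _ t0 (mem [set t in C | ~~ (s \subset t)]%SET)
    (fun t => #|t|) t0P.
  rewrite /= inE => /andP[mC /subsetPn[i si im]] mP.
  exists i => // t tC it; apply: contraT => nst.
  have tm := mP t; rewrite /= inE tC nst in tm; have {}tm := tm isT.
  have /forall_inP/(_ t tC) := chC m mC.
  case/orP => [mt|/subsetP/(_ i it)]; last by rewrite (negPf im).
  have /eqP mE : m == t by rewrite eqEcard mt.
  by rewrite mE it in im.
exists i => //; rewrite xE /up_sum big_mkcond [RHS]big_mkcond /=.
apply: eq_bigr => t _; rewrite /ext.
case: (boolP (t \in C)) => tC; last by do 2 case: ifP.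
case: (boolP (i \in t)) => it; first by rewrite iP.
by case: ifP => // /subsetP/(_ i si); rewrite (negPf it).
Qed.

Let up_sum_inj (l m : {set 'I_n} -> R) :
  (forall s, s != set0 -> up_sum l s = up_sum m s) ->
  forall s, s != set0 -> l s = m s.
Proof.
move=> H s; have [k] := ubnP (#|~: s|)%SET; elim: k s => // k IH s sk s0.
have := H s s0; rewrite /up_sum (bigD1 s) //= [in RHS](bigD1 s) //=.
rewrite (_ : \sum_(t | _) l t = \sum_(t : {set 'I_n} | (s \subset t) && (t != s)) m t).
  by move/addIr.
apply: eq_bigr => t /andP[st ts]; apply: IH.
  rewrite (leq_trans _ (ltnSE sk)) //; apply: proper_card.
  by rewrite properEneq setCS st (inj_eq (can_inj (@setCK _))) ts.
by apply: contraNneq s0 => t0; rewrite -subset0 -t0.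
Qed.

Lemma lovaszE f C lam : set0 \notin K ->
  C \in order_complex -> barycentric_weights C lam ->
  lovasz f (\sum_(s in C) lam s *: indicator s) = \sum_(s in C) lam s * f s.
Proof.
move=> K0 CK wC; apply: xget_unique; first by exists C, lam.
move=> y [D [mu [DK wD xE ->]]].
have extE B (l : {set 'I_n} -> R) : B \in order_complex ->
    \sum_(s in B) l s * f s = \sum_(s : {set 'I_n} | s != set0) ext B l s * f s.
  rewrite inE => /and3P[_ /subsetP BK _].
  rewrite big_mkcond [RHS]big_mkcond /=; apply: eq_bigr => s _; rewrite /ext.
  case: (boolP (s \in B)) => sB; last by rewrite mul0r; case: ifP.
  by case: eqP => // s0; move: (BK _ sB) K0; rewrite s0 => ->.
rewrite !extE //; apply: eq_bigr => s s0; congr (_ * _).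
apply: up_sum_inj s s0 => s s0.
have /= [leD [i si eD]] := up_sum_min DK wD s0.
have /= [leC [j sj eC]] := up_sum_min CK wC s0.
rewrite -xE in leD eD; apply/eqP; rewrite eq_le.
by rewrite {1}eC leD //= [leRHS]eD leC.
Qed.

End Lovasz.

(* Main.v *)
Require Import Defs.
From mathcomp Require Import finmap boolp classical_sets cardinality.
From mathcomp Require Import all_boot all_order all_algebra.
From mathcomp Require Import reals.

(* The relative homology of (closed lower star, lower link) at a vertex s of the
   order complex is the homology of the family of chains through s in the lower
   set {t | f t <= f s}, because these are the simplices of the first complex
   that are not in the second.  If t is an upper exception of s, every element
   of the lower set that properly contains s contains t, so the family is a cone
   with apex t.  If s :\ v is a lower exception, every face of s containing v is
   in the lower set except s :\ v + v = s itself, and t <= v |: t >= [set v]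
   contracts the lower faces of s.  If s is critical, the lower set of s
   consists of the faces of s, and the family computes the reduced homology of
   the boundary of a simplex, shifted by one degree. *)

Set Implicit Arguments.
Unset Strict Implicit.
Unset Printing Implicit Defensive.

Import Order.TTheory GRing.Theory Num.Theory.

(** * Homology of convex families of simplices *)

Section RelativeHomology.
Local Open Scope ring_scope.

Variables (F : fieldType) (T : finType).
Implicit Types (D E X A : {set {set T}}) (s t u : {set T}) (c b : chain F T).

Local Notation bd := (@boundary_fun F T).

(** For v in s with [s :\ v] nonempty this is [incidence F s (s :\ v)], without the sum over
    vertices. *)
Definition orientation_sign (s : {set T}) (v : T) : F :=
  (-1) ^+ #|[set w in s | (enum_rank w < enum_rank v)%N]|.

Local Notation eps := orientation_sign.

Lemma orientation_signK s v (x : F) : eps s v * (eps s v * x) = x.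
Proof. by rewrite mulrA -expr2 sqrr_sign mul1r. Qed.

Lemma orientation_sign_rem s a v : a \in s ->
  eps s v = (-1) ^+ (enum_rank a < enum_rank v)%N * eps (s :\ a) v.
Proof.
move=> sa; rewrite /eps (cardD1 a) inE sa /= exprD; congr (_ * _ ^+ _).
by apply: eq_card => w; rewrite !inE andbA.
Qed.

(** Deleting the earlier of a and v shifts the position of the later one, while deleting the later
    shifts nothing; hence exactly one of the two signs changes. *)
Lemma orientation_sign_swap s a v : a \in s -> v \in s -> a != v ->
  eps s v * eps (s :\ v) a = - (eps s a * eps (s :\ a) v).
Proof.
move=> sa sv av.
rewrite (orientation_sign_rem v sa) (orientation_sign_rem a sv).
have [lt|gt|/val_inj/enum_rank_inj/eqP] := ltngtP (enum_rank a) (enum_rank v).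
- by rewrite /= expr0 expr1 mul1r !mulN1r !mulNr [eps _ v * _]mulrC.
- by rewrite /= expr0 expr1 mul1r !mulN1r !mulNr opprK [eps _ v * _]mulrC.
- by rewrite (negPf av).
Qed.

Lemma incidence_neq0 s t : incidence F s t != 0 ->
  [/\ t != set0, t \subset s & #|s| = #|t|.+1].
Proof.
rewrite /incidence; case: (t =P set0) => [_|/eqP t0]; first by rewrite eqxx.
have [v /andP[sv /eqP ->] _|nov] := pickP [pred v | (v \in s) && (t == s :\ v)].
  by split=> //; rewrite ?subsetDl // (cardsD1 v s) sv.
by rewrite big_pred0 ?eqxx.
Qed.

(** Reindexing by the vertex v to be added to t makes the later arguments about cofaces sums over
    vertices. *)
Lemma boundary_funE c t : t != set0 ->
  bd c t = \sum_(v | v \notin t) eps (v |: t) v * c (v |: t).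
Proof.
move=> t0; rewrite ffunE /incidence (negPf t0).
transitivity (\sum_(s : {set T}) \sum_(v in s | t == s :\ v) eps s v * c s).
  by apply: eq_bigr => s _; rewrite mulr_sumr; apply: eq_bigr => v _; rewrite mulrC.
rewrite (exchange_big_dep xpredT) //= [RHS]big_mkcond /=; apply: eq_bigr => v _.
have [tv|tv] := boolP (v \in t) => /=.
  by rewrite big_pred0 // => s; apply/andP => -[_ /eqP ts]; rewrite ts !inE eqxx in tv.
rewrite (big_pred1 (v |: t)) // => s; apply/andP/eqP => [[sv /eqP ->]|->].
  by rewrite setD1K.
by rewrite setU11 setU1K.
Qed.

Lemma boundary_fun0 c : bd c set0 = 0.
Proof.
rewrite ffunE big1 // => s _; by rewrite /incidence eqxx mulr0.
Qed.

Lemma boundary_fun_neq0 c t : bd c t != 0 ->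
  exists s, [/\ c s != 0, t != set0, t \subset s & #|s| = #|t|.+1].
Proof.
have [s /andP[cs /incidence_neq0[]]|no] :=
  pickP [pred s | (c s != 0) && (incidence F s t != 0)]; first by exists s.
rewrite ffunE big1 ?eqxx // => s _; apply/eqP; rewrite mulf_eq0.
by move: (no s) => /=; rewrite -negb_or => /negbFE.
Qed.

Lemma boundary_funK c t : bd (bd c) t = 0.
Proof.
have [->|t0] := eqVneq t set0; first exact: boundary_fun0.
have vt0 v : v |: t != set0 by apply/set0Pn; exists v; rewrite setU11.
rewrite boundary_funE //.
(* The contribution of reaching t by removing w and then v; it is antisymmetric in v and w. *)
pose G v w := eps (v |: t) v * (eps (w |: (v |: t)) w * c (w |: (v |: t))).
have GN v w : v != w -> v \notin t -> w \notin t -> G v w = - G w v.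
  move=> vw vt wt; rewrite /G setUCA; set u := v |: (w |: t).
  have e1 : v |: t = u :\ w.
    by rewrite /u setUCA setU1K // !inE negb_or eq_sym vw.
  have e2 : w |: t = u :\ v by rewrite /u setU1K // !inE negb_or vw.
  rewrite !mulrA -mulNr; congr (_ * _); rewrite e1 e2 mulrC.
  rewrite orientation_sign_swap ?setU11 //; last by rewrite !inE eqxx orbT.
  by rewrite [in RHS]mulrC.
transitivity (\sum_(v | v \notin t) \sum_(w | (w \notin t) && (w != v)) G v w).
  apply: eq_bigr => v vt; rewrite boundary_funE // mulr_sumr.
  by apply: eq_bigl => w; rewrite !inE negb_or andbC.
(* Cutting the double sum by the order of v and w makes opposite terms cancel in pairs; antisymmetry
   of the whole sum would not suffice in characteristic 2. *)
pose lt (v w : T) := (enum_rank v < enum_rank w)%N.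
transitivity (\sum_(v | v \notin t) \sum_(w | (w \notin t) && lt v w) G v w +
              \sum_(v | v \notin t) \sum_(w | (w \notin t) && lt w v) G v w).
  rewrite -big_split; apply: eq_bigr => v vt /=.
  rewrite (bigID (lt v)) /=; congr (_ + _); apply: eq_bigl => w;
    rewrite /lt -(inj_eq enum_rank_inj) -val_eqE /=;
    by case: (w \in t) => //=; case: ltngtP.
rewrite [X in _ + X](exchange_big_dep (fun w => w \notin t)) /=; last first.
  by move=> v w _ /andP[].
rewrite -big_split big1 //= => v vt.
rewrite [X in _ + X](eq_bigl (fun w => (w \notin t) && lt v w)).
  rewrite -big_split big1 //= => w /andP[wt vw]; rewrite GN ?addNr //.
  by apply: contraTneq vw => ->; rewrite /lt ltnn.
by move=> w; rewrite vt.
Qed.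

(** Differences of two subcomplexes have this property; it makes the boundary cut down to D square
    to zero. *)
Definition convex_family D := forall s t u,
  s \in D -> u \in D -> s \subset t -> t \subset u -> t \in D.

Definition supported D (k : nat) c :=
  forall s, c s != 0 -> (s \in D) && (#|s| == k).

(* The differential is that of the quotient of the chains on the faces of D by
   those outside D, so k-element sets have degree k - 1. *)
Definition acyclic_at D (k : nat) := forall c, supported D k c ->
  (forall t, t \in D -> bd c t = 0) ->
  exists2 b, supported D k.+1 b & forall t, t \in D -> bd b t = c t.

Lemma supported_eq0 D k c s : supported D k c -> ~~ ((s \in D) && (#|s| == k)) ->
  c s = 0.
Proof. by move=> cD; apply: contraNeq => /cD. Qed.

Lemma acyclic_at0 D : set0 \notin D -> acyclic_at D 0.
Proof.
move=> D0 c cD _.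
have c0 s : c s = 0.
  apply: (supported_eq0 cD); apply/andP => -[sD /eqP/cards0_eq s0].
  by rewrite s0 (negPf D0) in sD.
exists 0 => [s|t tD]; first by rewrite ffunE eqxx.
by rewrite -/bd c0 ffunE big1 // => s _; rewrite ffunE mul0r.
Qed.

(** Adjoining a is a contracting homotopy. As [set0] is not in D, closure under removal of a also
    excludes [[set a]], so no class of degree 0 survives. *)
Lemma cone_acyclic D k a : set0 \notin D ->
  (forall s, s \in D -> (a |: s \in D) && (s :\ a \in D)) -> acyclic_at D k.
Proof.
move=> D0 Da c cD cZ.
have Dn0 s : s \in D -> s != set0 by apply: contraTneq => ->.
pose h : chain F T := [ffun s : {set T} => if a \in s then eps s a * c (s :\ a) else 0].
exists h => [s|t tD].
  rewrite ffunE; case: ifP => [sa|]; last by rewrite eqxx.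
  rewrite mulf_eq0 negb_or => /andP[_ /cD/andP[/Da/andP[+ _] /eqP <-]].
  by rewrite setD1K // => ->; rewrite (cardsD1 a s) sa /=.
have t0 := Dn0 _ tD; have ta0 : t :\ a != set0 by have /andP[_ /Dn0] := Da _ tD.
rewrite boundary_funE //; have [ta|ta] := boolP (a \in t); last first.
  rewrite (bigD1 a) //= ffunE setU11 setU1K // orientation_signK.
  rewrite big1 ?addr0 // => v /andP[vt va]; rewrite ffunE !inE (negPf ta).
  by rewrite eq_sym (negPf va) mulr0.
(* The cycle condition at [t :\ a] expresses c at t through the sets [v |: t :\ a], which are the
   ones occurring in the boundary of h at t. *)
have /andP[_ /cZ] := Da _ tD; rewrite boundary_funE //.
rewrite (bigD1 a) ?setD11 //= setD1K // => /(congr1 (fun x => eps t a * x)).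
rewrite mulr0 mulrDr orientation_signK => /eqP; rewrite addr_eq0 => /eqP ->.
rewrite mulr_sumr -sumrN; apply: eq_big => v.
  by rewrite !inE negb_and negbK andb_orl andbN /= andbC;
    case: eqVneq => // ->; rewrite ta.
move=> vt; have av : a != v by apply: contraTneq ta => ->.
have e1 : (v |: t) :\ a = v |: t :\ a.
  by apply/setP => w; rewrite !inE; case: eqVneq => // ->; rewrite (negPf av).
have ats : a \in v |: t by rewrite !inE ta orbT.
rewrite ffunE ats -e1 !mulrA -mulNr; congr (_ * _).
have := orientation_sign_swap ats (setU11 v t) av; rewrite setU1K // => H.
have sq r w : eps r w * eps r w = 1 by rewrite -expr2 sqrr_sign.
rewrite -[LHS]mulr1 -(sq t a) mulrACA H mulNr mulrACA sq mul1r.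
by rewrite [in RHS]mulrC.
Qed.

Lemma boundary_funD b c t : bd (b + c) t = bd b t + bd c t.
Proof. by rewrite linearD ffunE. Qed.

Lemma boundary_funB b c t : bd (b - c) t = bd b t - bd c t.
Proof. by rewrite linearB !ffunE. Qed.

Definition restrict_chain D c : chain F T := [ffun s => if s \in D then c s else 0].

Lemma restrict_chainE D c s : restrict_chain D c s = if s \in D then c s else 0.
Proof. by rewrite ffunE. Qed.

Lemma chainB b c s : (b - c) s = b s - c s.
Proof. by rewrite !ffunE. Qed.

Lemma supported_restrict D E k c : supported E k c ->
  supported (E :&: D) k (restrict_chain D c).
Proof.
move=> cE s; rewrite restrict_chainE inE.
by case: ifP => [_ /cE/andP[-> ->]|]; last by rewrite eqxx.
Qed.

Lemma supported_boundary D k c : supported D k.+1 c ->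
  supported D k (restrict_chain D (bd c)).
Proof.
move=> cD s; rewrite restrict_chainE; case: ifP => [sD|]; last by rewrite eqxx.
by move=> /boundary_fun_neq0[t [/cD/andP[_ /eqP->] _ _ [->]]] /=.
Qed.

Lemma supportedS D E k c : D \subset E -> supported D k c -> supported E k c.
Proof. by move=> /subsetP DE cD s /cD/andP[/DE -> ->]. Qed.

Lemma supportedD D k b c : supported D k b -> supported D k c ->
  supported D k (b + c).
Proof.
move=> bD cD s; rewrite ffunE; apply: contraNT => sD.
by rewrite (supported_eq0 bD) ?(supported_eq0 cD) ?addr0.
Qed.

Lemma supportedB D k b c : supported D k b -> supported D k c ->
  supported D k (b - c).
Proof.
move=> bD cD s; rewrite !ffunE; apply: contraNT => sD.
by rewrite (supported_eq0 bD) ?(supported_eq0 cD) ?subr0.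
Qed.

(** A set between t and the support of c lies in D by convexity, so cutting the inner boundary down
    to D changes nothing in the double boundary at t. *)
Lemma boundary_restrict_boundary D k c t : convex_family D -> supported D k c ->
  t \in D -> bd (restrict_chain D (bd c)) t = 0.
Proof.
move=> D_convex cD tD; have [->|t0] := eqVneq t set0; first exact: boundary_fun0.
rewrite -(boundary_funK c t) !boundary_funE //; apply: eq_bigr => v _.
rewrite restrict_chainE; case: ifP => // /negbT vtD; congr (_ * _); apply/esym.
apply: contraNeq vtD => /boundary_fun_neq0[s [/cD/andP[sD _] _ vts _]].
exact: D_convex tD sD (subsetUr _ _) vts.
Qed.

(** On a single set the differential vanishes, and the chains form a line for k equal to [#|s|] and
    are zero otherwise. *)
Lemma acyclic_at_set1 (s : {set T}) k : acyclic_at [set s] k <-> k <> #|s|.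
Proof.
have bd0 j c : supported [set s] j c -> bd c s = 0.
  move=> cD; apply: contraTeq isT => /boundary_fun_neq0[t [/cD]].
  by rewrite inE => /andP[/eqP-> _] _ _ /eqP; rewrite eqn_leq ltnn andbF.
split=> [ac ks|ks c cD _].
  have c1 : supported [set s] k (simplex_chain F s).
    move=> t; rewrite ffunE inE; case: (t =P s) => [->|_]; last by rewrite eqxx.
    by rewrite ks eqxx.
  have [|b bD bE] := ac _ c1; first by move=> t /set1P ->; apply: bd0 c1.
  have := bE s (set11 _); rewrite (bd0 _ _ bD) ffunE eqxx => /eqP.
  by rewrite eq_sym oner_eq0.
have c0 t : c t = 0.
  by apply: (supported_eq0 cD); rewrite inE; apply/andP => -[/eqP-> /eqP/esym].
exists 0 => [t|t /set1P ->]; first by rewrite ffunE eqxx.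
by rewrite linear0 ffunE c0.
Qed.

(** * Splitting a family by membership of a vertex *)

Section Deletion.
Variables (D : {set {set T}}) (x : T).
Hypotheses (D_convex : convex_family D) (D0 : set0 \notin D).

Local Notation Dx := [set s in D | x \in s].
Local Notation D'x := [set s in D | x \notin s].
Hypothesis D'x_acyclic : forall k, acyclic_at D'x k.

Let Dx_sub : Dx \subset D. Proof. by apply/subsetP => s; rewrite inE => /andP[]. Qed.
Let D'x_sub : D'x \subset D. Proof. by apply/subsetP => s; rewrite inE => /andP[]. Qed.

Let restrict_x c := restrict_chain [set s : {set T} | x \in s] c.

Let supported_x k c : supported D k c -> supported Dx k (restrict_x c).
Proof.
move=> /(supported_restrict (D := [set s : {set T} | x \in s])); apply: supportedS.
by apply/subsetP => s; rewrite !inE.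
Qed.

Let boundary_x c t : x \in t -> bd (restrict_x c) t = bd c t.
Proof.
move=> xt; have t0 : t != set0 by apply/set0Pn; exists x.
rewrite !boundary_funE //; apply: eq_bigr => v _.
by rewrite restrict_chainE !inE xt orbT.
Qed.

Let boundary_D'x k b t : supported D'x k b -> x \in t -> bd b t = 0.
Proof.
move=> bD xt; apply: contraTeq xt => /boundary_fun_neq0[s [/bD]].
by rewrite inE => /andP[/andP[_ xs] _] _ /subsetP ts _; apply: contra xs => /ts.
Qed.

(** The chains on [D'x] form a subcomplex of those on D with quotient the chains on [Dx]; this is
    the long exact sequence with the acyclic term removed, done by a chase in both directions. *)
Lemma acyclic_deletion k : acyclic_at D k <-> acyclic_at Dx k.
Proof.
split=> [ac|ac] c cD cZ; last first.
  have [t|b1 b1D b1E] := ac (restrict_x c) (supported_x cD).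
    by rewrite inE => /andP[tD xt]; rewrite boundary_x ?cZ.
  (* [b1] fills c on the sets containing x, so [c - e] is a cycle supported on [D'x] and is filled
     there by [b2]. *)
  set e := restrict_chain D (bd b1).
  have b1D' := supportedS Dx_sub b1D.
  have ceD : supported D k (c - e) by apply/supportedB/supported_boundary.
  have [| |b2 b2D b2E] := @D'x_acyclic k (c - e).
  - move=> s se; rewrite inE (andP (ceD s se)).1 (andP (ceD s se)).2 andbT /=.
    apply: contra se => xs; rewrite chainB restrict_chainE.
    case: ifP => sD; last by rewrite (supported_eq0 cD) ?sD ?subr0.
    by have := b1E s; rewrite restrict_chainE !inE sD xs => ->; rewrite ?subrr.
  - move=> t; rewrite inE => /andP[tD xt].
    by rewrite boundary_funB cZ // (boundary_restrict_boundary D_convex b1D') ?subr0.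
  exists (b1 + b2); first exact/supportedD/(supportedS D'x_sub).
  move=> t tD; rewrite boundary_funD; have [xt|xt] := boolP (x \in t).
    by rewrite b1E ?inE ?tD // (boundary_D'x b2D xt) addr0 restrict_chainE inE xt.
  by rewrite b2E ?inE ?tD // chainB restrict_chainE tD addrC subrK.
(* The boundary of c lives one degree lower, so degree 0, where there are no sets, is set apart. *)
case: k => [|k] in ac c cD cZ *.
  by apply: acyclic_at0 => //; rewrite inE (negPf D0).
have cD' := supportedS Dx_sub cD.
(* A cycle c on [Dx] need not be one on D, but its boundary in D avoids x and is a cycle of [D'x];
   subtracting a filling [b2] of it corrects c without touching the sets containing x. *)
have [| |b2 b2D b2E] := @D'x_acyclic k (restrict_chain D (bd c)).
- move=> s; have := supported_boundary cD' (s := s); rewrite restrict_chainE inE.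
  case: ifP => [sD|]; last by rewrite eqxx.
  move=> H sn0; have {H} /= sk := H sn0; rewrite ?inE ?sD sk andbT /=.
  by apply: contra sn0 => xs; rewrite cZ // inE sD.
- move=> t; rewrite inE => /andP[tD _].
  exact: boundary_restrict_boundary cD' tD.
have [| |b bD bE] := ac (c - b2).
- exact/supportedB/(supportedS D'x_sub).
- move=> t tD; rewrite boundary_funB; have [xt|xt] := boolP (x \in t).
    by rewrite cZ ?inE ?tD // (boundary_D'x b2D xt) subr0.
  by rewrite b2E ?inE ?tD // restrict_chainE tD subrr.
exists (restrict_x b); first exact: supported_x.
move=> t; rewrite inE => /andP[tD xt]; rewrite boundary_x // bE // chainB.
by rewrite (supported_eq0 b2D) ?subr0 // inE xt andbF.
Qed.

End Deletion.

(** * Relative Betti numbers of a pair of complexes *)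

Section Betti.
Variables (X A : {set {set T}}).
Hypotheses (X0 : set0 \notin X) (AX : A \subset X).
Hypothesis X_faces : forall s t, s \in X -> t \subset s -> t != set0 -> t \in X.
Hypothesis A_faces : forall s t, s \in A -> t \subset s -> t != set0 -> t \in A.

Lemma chain_spaceP (Y : {set {set T}}) i c :
  reflect (supported Y i.+1 c) (c \in chain_space F Y i).
Proof.
apply: (iffP idP) => [cY s|cY].
  apply: contraNT => sY.
  rewrite (coord_span (X := in_tuple _) cY) sum_ffunE big1 // => j _.
  rewrite ffunE; set l := [seq _ | _ <- _ & _].
  have /mapP[t] : l`_j \in l by apply: mem_nth; rewrite ltn_ord.
  rewrite mem_filter mem_enum => /andP[ti tY] ->; rewrite ffunE.
  by case: eqP => [st|_]; [rewrite st tY ti in sY|rewrite scaler0].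
have -> : c = \sum_(s in Y | #|s| == i.+1) c s *: simplex_chain F s.
  apply/ffunP => t; rewrite sum_ffunE big_mkcond (bigD1 t) //= big1 => [|s st].
    rewrite addr0 !ffunE eqxx; case: ifP => [_|/negbT/(supported_eq0 cY)//].
    by rewrite /GRing.scale /= mulr1.
  case: ifP => // _; rewrite !ffunE eq_sym (negPf st); exact: scaler0.
apply: memv_suml => s /andP[sY si]; apply/memvZ/memv_span/mapP; exists s => //.
by rewrite mem_filter si mem_enum.
Qed.

Let D := X :\: A.

Let boundary_sub (Y : {set {set T}}) k c t : supported Y k c ->
  (forall s t, s \in Y -> t \subset s -> t != set0 -> t \in Y) ->
  bd c t != 0 -> (t \in Y) && (#|t|.+1 == k).
Proof.
move=> cY Yf /boundary_fun_neq0[s [/cY/andP[sY /eqP sk] t0 ts st]].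
by rewrite -sk st eqxx (Yf s).
Qed.

Let boundaryE c : boundary F T c = bd c. Proof. by rewrite lfunE. Qed.

Lemma relative_cyclesP i c :
  reflect (supported X i.+1 c /\ forall t, t \in D -> bd c t = 0)
          (c \in relative_cycles F X A i).
Proof.
rewrite /relative_cycles memv_cap -memv_preim boundaryE.
apply: (iffP andP) => [[/chain_spaceP cX /chain_spaceP cZ]|[cX cZ]].
  split=> // t; rewrite inE => /andP[tA _].
  by apply: (supported_eq0 cZ); rewrite (negPf tA).
split; first exact/chain_spaceP.
apply/chain_spaceP => t bt.
have /andP[tX /eqP [ti]] := boundary_sub cX X_faces bt.
(* The truncated [i.-1] is harmless: t has i elements and is nonempty, so i is positive. *)
have tn0 : (0 < #|t|)%N by rewrite card_gt0; apply: contraTneq tX => ->.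
rewrite -ti prednK // eqxx andbT; apply: contraNT bt => tA.
by rewrite cZ // inE tA.
Qed.

Lemma relative_boundariesP i c :
  reflect (exists2 b, supported X i.+2 b & supported A i.+1 (c - bd b))
          (c \in relative_boundaries F X A i).
Proof.
apply: (iffP memv_addP) => [[_ /memv_imgP[b bX ->] [a aA ->]]|[b bX cA]].
  exists b; first exact/chain_spaceP.
  by rewrite boundaryE addrC addKr; apply/chain_spaceP.
exists (bd b); first by rewrite -boundaryE; apply/memv_img/chain_spaceP.
exists (c - bd b); first exact/chain_spaceP.
by rewrite addrCA subrr addr0.
Qed.

Let D_sub : D \subset X. Proof. exact: subsetDl. Qed.

Let boundary_A k c t : supported A k c -> t \in D -> bd c t = 0.
Proof.
move=> cA; apply: contraTeq => /(boundary_sub cA A_faces)/andP[tA _].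
by rewrite inE tA.
Qed.

Let sub_restrict k c : supported X k c -> supported A k (c - restrict_chain D c).
Proof.
move=> cX s; rewrite chainB restrict_chainE inE.
case: ifP => [_|sD]; first by rewrite subrr eqxx.
rewrite subr0 => /cX/andP[sX ->]; rewrite andbT.
by move: sD; rewrite sX andbT => /negbFE.
Qed.

Let boundary_restrict k c t : supported X k c -> t \in D ->
  bd (restrict_chain D c) t = bd c t.
Proof.
move=> cX tD; have := boundary_A (sub_restrict cX) tD.
by rewrite boundary_funB => /eqP; rewrite subr_eq0 => /eqP ->.
Qed.

Let supported_D k c : supported X k c -> supported D k (restrict_chain D c).
Proof. by move=> /(supported_restrict (D := D)); apply/supportedS/subsetIr. Qed.

(** Modulo chains on A, only the coefficients on D remain. The index shifts because an i-simplex has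
    i + 1 elements. *)
Lemma betti_eq0 i : betti F X A i = 0%N <-> acyclic_at D i.+1.
Proof.
(* Boundaries being cycles, a zero difference of dimensions forces the two spaces to be equal. *)
have BZ : (relative_boundaries F X A i <= relative_cycles F X A i)%VS.
  apply/subvP => c /relative_boundariesP[b bX cA].
  apply/relative_cyclesP; split=> [s|t tD].
    apply: contraNT => sX; have : (c - bd b) s = 0.
      apply: (supported_eq0 cA); apply: contra sX => /andP[sA ->].
      by rewrite (subsetP AX).
    rewrite chainB => /eqP; rewrite subr_eq0 => /eqP ->.
    by apply: contraNT sX => /(boundary_sub bX X_faces).
  have := boundary_A cA tD; rewrite boundary_funB boundary_funK => /eqP.
  by rewrite subr_eq0 => /eqP.
have -> : betti F X A i = 0%N <->
    (relative_cycles F X A i <= relative_boundaries F X A i)%VS.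
  split=> [/eqP|ZB]; last by apply/eqP; rewrite subn_eq0 dimvS.
  by rewrite subn_eq0 => dZ; have /eqP-> : relative_boundaries F X A i ==
    relative_cycles F X A i by rewrite eqEdim BZ.
split=> [/subvP ZB c cD cZ|ac].
  have [|b bX cA] := relative_boundariesP i c (ZB c _).
    by apply/relative_cyclesP; split=> //; apply: supportedS cD.
  exists (restrict_chain D b) => [|t tD]; first exact: supported_D.
  rewrite (boundary_restrict bX) //.
  have : (c - bd b) t = 0.
    by apply: (supported_eq0 cA); move: tD; rewrite inE => /andP[/negPf->].
  by rewrite chainB => /eqP; rewrite subr_eq0 => /eqP.
apply/subvP => c /relative_cyclesP[cX cZ]; apply/relative_boundariesP.
have [|t tD|b bD bE] := ac (restrict_chain D c); first exact: supported_D.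
  by rewrite (boundary_restrict cX) ?cZ.
exists b => [|s]; first exact: supportedS bD.
rewrite chainB.
have [sD|sD] := boolP (s \in D).
  by have := bE s sD; rewrite restrict_chainE sD => ->; rewrite subrr eqxx.
move=> cb; have /andP[sX ->] : (s \in X) && (#|s| == i.+1).
  apply: contraNT cb => sX; rewrite (supported_eq0 cX sX) sub0r oppr_eq0.
  by apply: contraNT sX => /(boundary_sub (supportedS D_sub bD) X_faces).
by move: sD; rewrite inE sX !andbT negbK.
Qed.

End Betti.
End RelativeHomology.

(** * Families of chains of sets *)

Section ChainFamilies.

Variables (F : fieldType) (n : nat).
Implicit Types (s t x : {set 'I_n}) (M Q U A C : {set {set 'I_n}}).

Definition nested s t := (s \subset t) || (t \subset s).

Lemma nested_refl s : nested s s.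
Proof. by rewrite /nested subxx. Qed.

Lemma nestedC s t : nested s t = nested t s.
Proof. exact: orbC. Qed.

Lemma is_chainP C : reflect {in C &, forall s t, nested s t} (is_chain C).
Proof.
apply: (iffP forall_inP) => [H s t sC tC|H s sC]; first exact: (forall_inP (H s sC)).
by apply/forall_inP => t; apply: H.
Qed.

Lemma is_chainS C C' : C \subset C' -> is_chain C' -> is_chain C.
Proof.
move=> /subsetP CC' /is_chainP ch; apply/is_chainP => s t /CC' sC /CC' tC.
exact: ch.
Qed.

Lemma is_chainU1 x C : is_chain C -> {in C, forall s, nested x s} ->
  is_chain (x |: C).
Proof.
move=> /is_chainP ch xC; apply/is_chainP => s t /setU1P[->|sC] /setU1P[->|tC].
- exact: nested_refl.
- exact: xC.
- by rewrite nestedC xC.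
- exact: ch.
Qed.

(** M is the flag required in every chain and Q the stock of permitted sets; the arguments below
    move a set from Q into M or discard it. *)
Definition chains_between M Q : {set {set {set 'I_n}}} :=
  [set C : {set {set 'I_n}} | [&& M \subset C, C \subset Q & is_chain C]].

Lemma chains_betweenP M Q C :
  reflect [/\ M \subset C, C \subset Q & is_chain C] (C \in chains_between M Q).
Proof. by rewrite inE; apply: and3P. Qed.

Lemma chains_between_convex M Q : convex_family (chains_between M Q).
Proof.
move=> C1 C2 C3 /chains_betweenP[MC1 _ _] /chains_betweenP[_ C3Q ch3] C12 C23.
apply/chains_betweenP; split; first exact: subset_trans C12.
  exact: subset_trans C3Q.
exact: is_chainS ch3.
Qed.

Lemma set0_chains_between M Q : M != set0 -> set0 \notin chains_between M Q.
Proof.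
by move=> M0; apply: contraNN M0 => /chains_betweenP[+ _ _]; rewrite subset0.
Qed.

(** All members of a chain through M are nested with the sets of M, so only those elements of Q
    matter. *)
Lemma eq_chains_between M Q Q' :
  (forall q, {in M, forall m, nested q m} -> (q \in Q) = (q \in Q')) ->
  chains_between M Q = chains_between M Q'.
Proof.
move=> QQ'; apply/setP => C; rewrite !inE.
have [MC /=|//] := boolP (M \subset C).
have [ch|] := boolP (is_chain C); last by rewrite !andbF.
rewrite !andbT; apply/subsetP/subsetP => CQ q qC; have := CQ q qC;
  rewrite QQ' // => m /(subsetP MC) mC; exact: (is_chainP _ ch).
Qed.

Lemma chains_between_with M Q x :
  [set C in chains_between M Q | x \in C] = chains_between (x |: M) Q.
Proof.
by apply/setP => C; rewrite !inE subUset sub1set andbC -!andbA.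
Qed.

Lemma chains_between_without M Q x :
  [set C in chains_between M Q | x \notin C] = chains_between M (Q :\ x).
Proof.
apply/setP => C; rewrite !inE subsetD1.
by case: (_ \subset _) (_ \subset _) (x \in C) (is_chain C) => [] [] [] [].
Qed.

Lemma chains_between_cone M Q a k : M != set0 -> a \in Q -> a \notin M ->
  {in Q, forall q, {in M, forall m, nested q m} -> nested a q} ->
  acyclic_at F (chains_between M Q) k.
Proof.
move=> M0 aQ aM aN; apply: (@cone_acyclic _ _ _ _ a).
  exact: set0_chains_between.
move=> C /chains_betweenP[MC CQ ch]; apply/andP; split; apply/chains_betweenP.
  split; first by rewrite subsetU // MC orbT.
    by rewrite subUset sub1set aQ.
  apply: is_chainU1 => // q qC; apply: aN => [|m mM]; first exact: (subsetP CQ).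
  by apply: (is_chainP _ ch) => //; apply: (subsetP MC).
split; first by rewrite subsetD1 MC.
  by apply: subset_trans CQ; apply: subsetDl.
by apply: is_chainS ch; apply: subsetDl.
Qed.

Lemma acyclic_chains_deletion M Q x k : M != set0 ->
  (forall j, acyclic_at F (chains_between M (Q :\ x)) j) ->
  acyclic_at F (chains_between M Q) k <->
  acyclic_at F (chains_between (x |: M) Q) k.
Proof.
move=> M0 ac; rewrite -chains_between_with.
apply: acyclic_deletion => [||j]; first exact: chains_between_convex.
  exact: set0_chains_between.
by rewrite chains_between_without.
Qed.

(** A is contracted to [[set v]] along a, [v |: a], [[set v]], while U lies above all of it. The
    induction discards one by one the members of A that avoid v; once none is left, [[set v]] is an
    apex. *)
Lemma chains_between_contractible M U A v k : M != set0 -> M \subset U ->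
  {in A & U, forall a u : {set 'I_n}, a \proper u} -> [set v] \in A ->
  {in A, forall a, v |: a \in A} -> acyclic_at F (chains_between M (U :|: A)) k.
Proof.
have [m] := ubnP #|[set a in A | v \notin a]|.
elim: m => // m IH in M A k *; rewrite ltnS => Am M0 MU AU vA Av.
have AM a : a \in A -> a \notin M.
  by move=> aA; apply/negP => /(subsetP MU)/(AU _ _ aA); rewrite properxx.
have [A0|[x0 x0P]] := set_0Vmem [set a in A | v \notin a].
  apply: (@chains_between_cone _ _ [set v]) => //; first by rewrite inE vA orbT.
    exact: AM.
  move=> q + _; rewrite inE => /orP[qU|qA].
    by rewrite /nested (proper_sub (AU _ _ vA qU)).
  rewrite /nested sub1set; apply/orP; left; apply: contraT => vq.
  by have := in_set0 q; rewrite -A0 inE qA vq.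
(* By maximality of x, every larger member of A contains v and hence [v |: x], which is thus an apex
   for the chains through x. *)
have [x] := @arg_maxnP _ x0 (mem [set a in A | v \notin a]) (fun a => #|a|) x0P.
rewrite /= inE => /andP[xA vx] xmax.
have xU : x \notin U by apply/negP => /(AU _ _ xA); rewrite properxx.
have vxA := Av _ xA; have vx' : v |: x != x.
  by apply: contraNneq vx => <-; rewrite setU11.
rewrite (@acyclic_chains_deletion _ _ x) // => [|j].
  apply: (@chains_between_cone _ _ (v |: x)).
  - by apply/set0Pn; exists x; rewrite setU11.
  - by rewrite inE vxA orbT.
  - by rewrite inE negb_or inE vx' AM.
  move=> q; rewrite inE => /orP[qU _|qA qM].
    by rewrite /nested (proper_sub (AU _ _ vxA qU)).
  have := qM x (setU11 _ _); rewrite /nested => /orP[qx|xq].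
    by rewrite (subset_trans qx (subsetUr _ _)) orbT.
  have [->|qx] := eqVneq q x; first by rewrite subsetUr orbT.
  rewrite subUset sub1set xq andbT; have [//|vq] := boolP (v \in q).
  have := xmax q; rewrite /= inE qA vq => /(_ isT) qx'.
  by move: qx; rewrite eq_sym eqEcard xq qx'.
have -> : (U :|: A) :\ x = U :|: (A :\ x).
  by apply/setP => y; rewrite !inE; case: eqVneq => //= ->; rewrite (negPf xU).
apply: IH => //.
- apply: leq_trans Am; apply: proper_card; apply/properP; split.
    by apply/subsetP => y; rewrite !inE -andbA => /and3P[_ -> ->].
  by exists x; rewrite !inE ?xA ?vx ?eqxx.
- by move=> a u /setD1P[_]; apply: AU.
- by rewrite !inE vA andbT; apply: contraNneq vx => <-; rewrite inE.
- move=> a /setD1P[_ /Av avA]; rewrite !inE avA andbT.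
  by apply: contraNneq vx => <-; rewrite setU11.
Qed.

Definition proper_faces s : {set {set 'I_n}} :=
  [set t : {set 'I_n} | (t != set0) && (t \proper s)].

(* Deleting a facet [s :\ v] from the proper faces of s leaves a family that
   contracts to [set v], so that the flag M can be extended by [s :\ v] until
   it is complete, and the family of chains is reduced to one element. *)
Lemma acyclic_flag M s k : is_chain M -> s \in M ->
  {in M, forall m : {set 'I_n}, s \subset m} -> s != set0 ->
  acyclic_at F (chains_between M (M :|: proper_faces s)) k <->
  k.+1 <> (#|M| + #|s|)%N.
Proof.
have [m] := ubnP #|s|; elim: m => // m IH in M s *; rewrite ltnS => sm ch sM Ms s0.
have M0 : M != set0 by apply/set0Pn; exists s.
have [v vs] := set0Pn _ s0.
(* If s is a single vertex, the flag is complete: M is the only chain, with [#|M| + #|s| - 1]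
   elements. *)
have [x0|x0] := eqVneq (s :\ v) set0.
  have s1 : s = [set v] by rewrite -(setD1K vs) x0 setU0.
  have -> : proper_faces s = set0.
    apply/setP => t; rewrite !inE; apply/negP => /andP[t0 /proper_card].
    by rewrite s1 cards1 ltnS leqn0 cards_eq0 (negPf t0).
  have -> : chains_between M (M :|: set0) = [set M].
    apply/setP => C; rewrite setU0 !inE eqEsubset.
    case: (boolP (C \subset M)) => CM; last by rewrite andbF.
    by rewrite (is_chainS CM ch) !andbT.
  rewrite acyclic_at_set1 s1 cards1 addn1.
  by split=> [H [E]|H E]; apply: H; rewrite E.
have xs : s :\ v \proper s by apply: properD1.
have xM : s :\ v \notin M.
  by apply/negP => /Ms; rewrite subsetD1 vs andbF.
rewrite (@acyclic_chains_deletion _ _ (s :\ v)) // => [|j].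
  (* Among the proper faces of s, only [s :\ v] and its own faces are nested with [s :\ v], so the
     extended flag is of the same form. *)
  have -> : chains_between (s :\ v |: M) (M :|: proper_faces s) =
      chains_between (s :\ v |: M) ((s :\ v |: M) :|: proper_faces (s :\ v)).
    apply: eq_chains_between => q qM; rewrite !inE.
    have [->|qx] /= := eqVneq q (s :\ v); first by rewrite x0 xs orbT.
    congr (_ || (_ && _)).
    have /orP[qx'|xq] := qM _ (setU11 _ _).
      by rewrite (sub_proper_trans qx' xs) properEneq qx qx'.
    rewrite [RHS]properE xq andbF; apply/negP => qs.
    have := proper_card qs; rewrite [#|s|](cardsD1 v) vs add1n ltnS => qc.
    by move: qx; rewrite eq_sym eqEcard xq qc.
  rewrite IH //.
  - by rewrite cardsU1 xM (cardsD1 v s) vs addnCA addnA.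
  - by apply: leq_trans sm; apply: proper_card.
  - apply: is_chainU1 => // y yM; rewrite /nested.
    by rewrite (subset_trans (proper_sub xs) (Ms _ yM)).
  - exact: setU11.
  - move=> y /setU1P[->//|yM]; exact: subset_trans (proper_sub xs) (Ms _ yM).
have -> : (M :|: proper_faces s) :\ (s :\ v) = M :|: proper_faces s :\ (s :\ v).
  by apply/setP => y; rewrite !inE; case: eqVneq => //= ->; rewrite (negPf xM).
apply: (@chains_between_contractible _ _ _ v) => //.
- move=> a u; rewrite !inE => /and3P[_ _ as_] /Ms; exact: proper_sub_trans.
- rewrite !inE; apply/and3P; split.
  + by apply: contraTneq (set11 v) => ->; rewrite setD11.
  + by apply/set0Pn; exists v; rewrite set11.
  + rewrite properEneq sub1set vs andbT; apply: contraNneq x0 => <-.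
    by rewrite setDv.
- move=> a; rewrite !inE => /and3P[ax a0 as_]; apply/and3P; split.
  + by apply: contraTneq (setU11 v a) => ->; rewrite setD11.
  + by apply/set0Pn; exists v; rewrite setU11.
  (* Adding v could only leave the family by reaching s, and then a would be the deleted facet. *)
  + rewrite properEneq subUset sub1set vs (proper_sub as_) !andbT.
    apply: contraNneq ax => vas; have va : v \notin a.
      by apply/negP => va; move: as_; rewrite -vas (setUidPr _) ?sub1set // properxx.
    by rewrite -vas setU1K.
Qed.

End ChainFamilies.

(** * Lower sets of a discrete Morse function *)

Section MorseLowerSets.
Local Open Scope ring_scope.

Variables (R : realType) (F : fieldType) (n : nat).
Variables (K : {set {set 'I_n}}) (f : {set 'I_n} -> R).
Hypotheses (K_complex : simplicial_complex K) (f_morse : discrete_morse K f).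
Hypothesis f_inj : {in K &, injective f}.
Implicit Types (s t r : {set 'I_n}).

Let K_faces s t : s \in K -> t \subset s -> t != set0 -> t \in K.
Proof. by have [_ + _] := K_complex; apply. Qed.

Let K_neq0 s : s \in K -> s != set0.
Proof. by have [K0 _ _] := K_complex; apply: contraTneq => ->. Qed.

Lemma card_le1_pair (X : finType) (B : {set X}) x y :
  (#|B| <= 1)%N -> x \in B -> y \in B -> x = y.
Proof. by move=> /card_le1_eqP H xB yB; apply: H. Qed.

Lemma proper_setU1 s t x : t \subset s -> x \in s -> (#|t| < #|s|.-1)%N ->
  x |: t \proper s.
Proof.
move=> ts xs lt; rewrite properEcard subUset sub1set xs ts /= cardsU1.
by case: #|s| lt => // m /= lt; rewrite ltnS (leq_trans _ lt) // -add1n leq_add2r leq_b1.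
Qed.

(* If f t were at least f s, then any two simplices covering t inside s would
   be upper exceptions of t; the hypothesis starts the downward induction. *)
Lemma face_lt s t : s \in K -> t \in K -> t \proper s ->
  (forall r, t \subset r -> r \subset s -> #|s| = #|r|.+1 -> f r < f s) ->
  f t < f s.
Proof.
move=> sK; have [m] := ubnP (#|s| - #|t|)%N; elim: m t => // m IH t.
rewrite ltnS => tm tK ts H; have lt := proper_card ts.
have tK0 := K_neq0 tK.
have [e|ne] := eqVneq #|s| #|t|.+1; first exact: H (proper_sub ts) e.
have lt2 : (#|t| < #|s|.-1)%N.
  by case: #|s| lt ne => // k; rewrite ltnS leq_eqVlt eqSS eq_sym => /orP[->|].
have /(card_gt1P) [x [y [xD yD xy]]] : (1 < #|s :\: t|)%N.
  rewrite cardsD (setIidPr (proper_sub ts)) ltn_subRL addn1.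
  by case: #|s| lt2.
have H1 z : z \in s :\: t -> [/\ z |: t \in K, f (z |: t) < f s & #|z |: t| = #|t|.+1].
  rewrite inE => /andP[zt zs].
  have zts : z |: t \proper s by apply: proper_setU1 (proper_sub ts) zs lt2.
  have zK : z |: t \in K.
    apply: K_faces sK (proper_sub zts) _.
    by apply/set0Pn; exists z; rewrite setU11.
  have zc : #|z |: t| = #|t|.+1 by rewrite cardsU1 zt.
  split=> //; apply: IH => //.
    by rewrite zc subnS -ltnS prednK ?subn_gt0 ?(leq_trans tm).
  by move=> r /subUsetP[_ tr]; apply: H.
case: ltP => // fst.
have H2 z : z \in s :\: t -> z |: t \in upper_exceptions K f t.
  move=> /H1[zK fz zc]; rewrite inE zK subsetUr zc eqxx /=.
  exact: le_trans (ltW fz) fst.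
have := card_le1_pair (f_morse tK).1 (H2 _ xD) (H2 _ yD).
move=> /setP/(_ x); move: xD; rewrite !inE (negPf xy) eqxx => /andP[/negPf->].
by [].
Qed.

(** Dual to [face_lt]: were f t at most f s, two facets of t containing s would both be lower
    exceptions of t. The hypothesis starts the upward induction. *)
Lemma coface_lt s t : s \in K -> t \in K -> s \proper t ->
  (forall r, r \in K -> s \subset r -> r \subset t -> #|r| = #|s|.+1 -> f s < f r) ->
  f s < f t.
Proof.
move=> sK; have [m] := ubnP #|t|; elim: m t => // m IH t.
rewrite ltnS => tm tK st H; have lt := proper_card st.
have [e|ne] := eqVneq #|t| #|s|.+1; first exact: H (proper_sub st) _ e.
have lt2 : (#|s| < #|t|.-1)%N.
  by case: #|t| lt ne => // k; rewrite ltnS leq_eqVlt eqSS eq_sym => /orP[->|].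
have /(card_gt1P) [x [y [xD yD xy]]] : (1 < #|t :\: s|)%N.
  rewrite cardsD (setIidPr (proper_sub st)) ltn_subRL addn1.
  by case: #|t| lt2.
have H1 z : z \in t :\: s -> [/\ t :\ z \in K, f s < f (t :\ z) & #|t| = #|t :\ z|.+1].
  rewrite inE => /andP[zs zt].
  have zc : #|t| = #|t :\ z|.+1 by rewrite (cardsD1 z t) zt.
  have stz : s \proper t :\ z.
    by rewrite properEcard subsetD1 (proper_sub st) zs; rewrite zc in lt2.
  have zK : t :\ z \in K.
    apply: K_faces tK (subsetDl _ _) _.
    by apply: contraNneq (K_neq0 sK) => t0; move: stz; rewrite t0 properE sub0set andbF.
  split=> //; apply: IH => //; first by rewrite -zc.
  by move=> r rK sr /subsetD1P[rt _]; apply: H.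
case: ltP => // fst.
have H2 z : z \in t :\: s -> t :\ z \in lower_exceptions K f t.
  move=> /H1[zK fz zc]; rewrite inE zK subsetDl -zc eqxx /=.
  exact: le_trans fst (ltW fz).
have := card_le1_pair (f_morse tK).2 (H2 _ xD) (H2 _ yD).
by move=> /setP/(_ x); move: xD; rewrite !inE eqxx xy => /andP[_ ->].
Qed.

Definition lower_set s : {set {set 'I_n}} := [set t in K | f t <= f s].

Lemma acyclic_critical s k : s \in K ->
  upper_exceptions K f s = set0 -> lower_exceptions K f s = set0 ->
  acyclic_at F (chains_between [set s] (lower_set s)) k <-> k <> #|s|.
Proof.
move=> sK up0 lo0.
have lt t : t \in K -> t \proper s -> f t < f s.
  move=> tK ts; apply: face_lt => // r tr rs sr; rewrite ltNge; apply/negP => fsr.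
  have rK : r \in K.
    apply: K_faces sK rs _; apply: contraNneq (K_neq0 tK) => r0.
    by rewrite -subset0 -r0.
  by have := in_set0 r; rewrite -lo0 inE rK rs sr eqxx fsr.
have gt t : t \in K -> s \proper t -> f s < f t.
  move=> tK st; apply: coface_lt => // r rK sr _ rs; rewrite ltNge; apply/negP => fsr.
  by have := in_set0 r; rewrite -up0 inE rK sr rs eqxx fsr.
(* Without exceptions, f is smaller on all proper faces of s and larger on all proper cofaces, so
   the sets of the lower set nested with s are its faces. *)
have -> : chains_between [set s] (lower_set s) =
    chains_between [set s] ([set s] :|: proper_faces s).
  apply: eq_chains_between => q /(_ _ (set11 _)) qs; rewrite !inE.
  have [->|nqs] := eqVneq q s; first by rewrite sK lexx.
  have [qK|qK] := boolP (q \in K); last first.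
    symmetry; apply: contraNF qK => /andP[q0 qs'].
    exact: K_faces sK (proper_sub qs') q0.
  rewrite K_neq0 //=; case/orP: qs => [qs|sq].
    have qs' : q \proper s by rewrite properEneq nqs.
    by rewrite ltW ?lt.
  have sq' : s \proper q by rewrite properEneq eq_sym nqs.
  by rewrite leNgt gt // properE sq andbF.
rewrite acyclic_flag ?set11 ?K_neq0 ?cards1 //.
- by rewrite add1n; split=> [H E|H [E]]; apply: H; rewrite E.
- by apply/is_chainP => x y /set1P-> /set1P->; apply: nested_refl.
- by move=> m /set1P->.
Qed.

Lemma acyclic_upper_exception s t k : s \in K -> t \in upper_exceptions K f s ->
  acyclic_at F (chains_between [set s] (lower_set s)) k.
Proof.
move=> sK tU; have := tU; rewrite inE => /and4P[tK st /eqP tc fts].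
have nst : t != s by apply: contraTneq (leqnn #|t|) => e; rewrite {1}tc e ltnn.
apply: (@chains_between_cone _ _ _ _ t); rewrite -?card_gt0 ?cards1 ?inE ?tK //.
move=> q; rewrite inE => /andP[qK qs] /(_ _ (set11 _)) /orP[qs'|sq].
  by rewrite /nested (subset_trans qs' st) orbT.
have [->|nqs] := eqVneq q s; first by rewrite /nested st orbT.
rewrite /nested; case: (boolP (t \subset q)) => // tq.
(* If q does not contain t, no simplex covering s inside q is the unique upper exception t, so f
   increases from s to q. *)
have : f s < f q; last by rewrite ltNge qs.
apply: coface_lt => //; first by rewrite properEneq eq_sym nqs.
move=> r rK sr rq rc; rewrite ltNge; apply: contra tq => fr.
have rU : r \in upper_exceptions K f s by rewrite inE rK sr rc eqxx fr.
by rewrite (card_le1_pair (f_morse sK).1 tU rU).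
Qed.

Lemma acyclic_lower_exception s t k : s \in K -> t \in lower_exceptions K f s ->
  acyclic_at F (chains_between [set s] (lower_set s)) k.
Proof.
move=> sK tL; have := tL; rewrite inE => /and4P[tK ts /eqP tc fst].
have [v vs vt] : exists2 v, v \in s & v \notin t.
  by apply/subsetPn; apply/negP => /subset_leq_card; rewrite tc ltnn.
have tE : s = v |: t.
  by apply/esym/eqP; rewrite eqEcard subUset sub1set vs ts tc cardsU1 vt /=.
(* A is the part strictly below s, to be contracted to [[set v]]; U collects s and the part above
   it. *)
pose A := [set q in lower_set s | q \proper s].
pose U := s |: [set q in lower_set s | s \proper q].
(* Facets of s containing q contain v, so none of them is t, the only lower exception. *)
have lt q : q \in K -> v \in q -> q \proper s -> f q < f s.
  move=> qK vq qs; apply: face_lt => // r qr rs rc; rewrite ltNge; apply/negP => fr.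
  have rK : r \in K.
    apply: K_faces sK rs _; apply: contraNneq (K_neq0 qK) => r0.
    by rewrite -subset0 -r0.
  have rL : r \in lower_exceptions K f s by rewrite inE rK rs rc eqxx fr.
  by move: vt; rewrite (card_le1_pair (f_morse sK).2 tL rL) (subsetP qr).
have AE q : q \in K -> v \in q -> q \proper s -> q \in A.
  by move=> qK vq qs; rewrite !inE qK qs ltW ?lt.
have -> : chains_between [set s] (lower_set s) = chains_between [set s] (U :|: A).
  apply: eq_chains_between => q /(_ _ (set11 _)) qs; rewrite !inE.
  have [->|nqs] := eqVneq q s; first by rewrite sK lexx.
  case: (_ && _) => //=; case/orP: qs => qs.
    by rewrite [q \proper s]properEneq nqs qs orbT.
  by rewrite [s \proper q]properEneq eq_sym nqs qs.
apply: (@chains_between_contractible _ _ _ _ _ v).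
- by rewrite -card_gt0 cards1.
- by rewrite sub1set setU11.
- move=> a u; rewrite !inE => /andP[_ as_] /predU1P[->//|/andP[_ su]].
  exact: proper_trans su.
- have [_ _ /(_ v) vK] := K_complex; apply: AE => //; first exact: set11.
  rewrite properEcard sub1set vs cards1 tc ltnS card_gt0 /=.
  exact: K_neq0 tK.
- move=> a; rewrite !inE => /andP[/andP[aK fa] as_].
  have vas : v |: a \subset s by rewrite subUset sub1set vs proper_sub.
  have va0 : v |: a != set0 by apply/set0Pn; exists v; rewrite setU11.
  have vaK := K_faces sK vas va0.
  have : v |: a \in A; last by rewrite !inE.
  apply: AE => //; first exact: setU11.
  rewrite properEneq vas andbT; apply/negP => /eqP vaE.
  have va : v \notin a.
    by apply/negP => va; move: as_; rewrite -vaE (setUidPr _) ?sub1set // properxx.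
  have ta : a = t by rewrite -(setU1K va) vaE tE setU1K.
  (* Here injectivity enters: t in A would give f t = f s, so t is absent from A and adding v never
     reaches s. *)
  have := f_inj tK sK; rewrite -ta => /(_ _) ste.
  have e : a = s by apply: ste; apply/le_anti; rewrite fa ta.
  by move: as_; rewrite e properxx.
Qed.

Definition critical s :=
  (upper_exceptions K f s == set0) && (lower_exceptions K f s == set0).

Lemma acyclic_lower_set s k : s \in K ->
  acyclic_at F (chains_between [set s] (lower_set s)) k <->
  ~ (critical s /\ #|s| = k).
Proof.
move=> sK; rewrite /critical.
have [up0|[t tU]] := set_0Vmem (upper_exceptions K f s); last first.
  split=> [_ [/andP[/eqP up0]]|_]; last exact: acyclic_upper_exception tU.
  by move: tU; rewrite up0 inE.
have [lo0|[t tL]] := set_0Vmem (lower_exceptions K f s); last first.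
  split=> [_ [/andP[_ /eqP lo0]]|_]; last exact: acyclic_lower_exception tL.
  by move: tL; rewrite lo0 inE.
rewrite acyclic_critical // up0 lo0 eqxx; split=> [H [_ e]|H e]; apply: H => //.
Qed.

End MorseLowerSets.

(** * Critical points of the Lovasz extension *)

Section LovaszCritical.
Local Open Scope ring_scope.

Variables (R : realType) (F : fieldType) (n : nat).
Variables (K : {set {set 'I_n}}) (f : {set 'I_n} -> R).
Hypothesis K_complex : simplicial_complex K.
Implicit Types (s t r : {set 'I_n}) (C : {set {set 'I_n}}).

Local Notation S := (order_complex K).
Local Notation p := (@indicator R n).
Local Notation g := (lovasz K f).

Let K0 : set0 \notin K. Proof. by have [] := K_complex. Qed.

Lemma order_complexP C :
  reflect [/\ C != set0, C \subset K & is_chain C] (C \in S).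
Proof. by rewrite inE; apply: and3P. Qed.

Lemma order_complex_set1 s : ([set s] \in S) = (s \in K).
Proof.
apply/order_complexP/idP => [[_ + _]|sK]; first by rewrite sub1set.
split; [by apply/set0Pn; exists s; rewrite set11|by rewrite sub1set|].
by apply/is_chainP => x y /set1P-> /set1P->; apply: nested_refl.
Qed.

Lemma order_complex_faces C C' : C \in S -> C' \subset C -> C' != set0 -> C' \in S.
Proof.
move=> /order_complexP[_ CK ch] CC C'0; apply/order_complexP; split=> //.
  exact: subset_trans CK.
exact: is_chainS ch.
Qed.

Lemma barycentric_weights_vertex C s : s \in C ->
  barycentric_weights C (fun t => (t == s)%:R : R).
Proof.
move=> sC; split=> [t _|]; first exact: ler0n.
by rewrite (bigD1 s) //= eqxx big1 ?addr0 // => t /andP[_ /negPf->].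
Qed.

Lemma sum_vertex (E : lmodType R) C s (h : {set 'I_n} -> E) : s \in C ->
  \sum_(t in C) (t == s)%:R *: h t = h s.
Proof.
move=> sC; rewrite (bigD1 s) //= eqxx scale1r big1 ?addr0 // => t /andP[_ /negPf->].
exact: scale0r.
Qed.

Lemma lovasz_indicator s : s \in K -> g (p s) = f s.
Proof.
move=> sK; have sS : [set s] \in S by rewrite order_complex_set1.
have := lovaszE f K0 sS (barycentric_weights_vertex (set11 s)).
by rewrite sum_vertex ?set11 // (@sum_vertex R^o) ?set11.
Qed.

(** On a chain the extension is a convex combination of the values at the vertices, so a bound there
    extends to the simplex. *)
Lemma belowP s C : s \in K -> C \in S ->
  below p g s C <-> {in C, forall t, f t <= f s}.
Proof.
move=> sK CS; have [_ CK _] := order_complexP _ CS.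
rewrite /below lovasz_indicator //; split=> [bel t tC|le x [lam wC ->]].
  rewrite -(lovasz_indicator (subsetP CK _ tC)); apply: bel.
  exists (fun r => (r == t)%:R); first exact: barycentric_weights_vertex.
  by rewrite sum_vertex.
rewrite lovaszE //; have [lam0 lam1] := wC.
rewrite -[leRHS]mul1r -lam1 mulr_suml; apply: ler_sum => t tC.
by apply: ler_wpM2l; [exact: lam0|exact: le].
Qed.

Lemma lower_starE s : s \in K ->
  lower_star S p g s = chains_between [set s] (lower_set K f s).
Proof.
move=> sK; apply/setP => C; rewrite !inE sub1set.
have -> : (C \subset lower_set K f s) =
    (C \subset K) && [forall t in C, f t <= f s].
  apply/subsetP/andP => [H|[/subsetP CK /forall_inP le] t tC].
    split; first by apply/subsetP => t /H; rewrite inE => /andP[].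
    by apply/forall_inP => t /H; rewrite inE => /andP[].
  by rewrite inE CK //= le.
have [sC|_] /= := boolP (s \in C); last by rewrite andbF.
have C0 : C != set0 by apply/set0Pn; exists s.
rewrite C0 andbT /=; have [CK|] //= := boolP (C \subset K).
have [ch|] := boolP (is_chain C); last by rewrite andbF.
have CS : C \in S by apply/order_complexP.
rewrite /= andbT; apply/asboolP/forall_inP => H.
  by move=> t tC; apply: (belowP sK CS).1.
by apply/(belowP sK CS).
Qed.

Lemma lower_linkP s C : s \in K ->
  reflect [/\ C \in S, s \notin C, s |: C \in S & {in C, forall t, f t <= f s}]
          (C \in lower_link S p g s).
Proof.
move=> sK; have -> : (C \in lower_link S p g s) =
    [&& C \in S, (s \notin C) && (s |: C \in S) & `[< below p g s C >]].
  by rewrite [LHS]inE [in LHS]inE -andbA.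
apply: (iffP and3P) => [[CS /andP[sC sCS] /asboolP/(belowP sK CS)]|[CS sC sCS le]].
  by split.
by split; rewrite ?sC //; apply/asboolP/(belowP sK CS).
Qed.

Lemma betti_lower_star s i : s \in K ->
  betti F (face_closure (lower_star S p g s)) (lower_link S p g s) i = 0%N <->
  acyclic_at F (chains_between [set s] (lower_set K f s)) i.+1.
Proof.
move=> sK; set X := face_closure _; set A := lower_link _ _ _ _.
have XE C : reflect
    (C != set0 /\ exists2 C',
       C' \in chains_between [set s] (lower_set K f s) & C \subset C')
    (C \in X).
  rewrite inE lower_starE //; apply: (iffP andP) => -[C0].
    by move=> /exists_inP[C' C'L CC']; split=> //; exists C'.
  by move=> [C' C'L CC']; split=> //; apply/exists_inP; exists C'.
have AX : A \subset X.
  apply/subsetP => C /(lower_linkP _ sK)[CS sC sCS le]; apply/XE.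
  have [C0 CK _] := order_complexP _ CS; have [_ _ ch] := order_complexP _ sCS.
  split=> //; exists (s |: C); last exact: subsetUr.
  apply/chains_betweenP; split=> //; first exact: subsetUl.
  apply/subsetP => t /setU1P[->|tC]; first by rewrite inE sK lexx.
  by rewrite inE (subsetP CK) ?le.
have <- : X :\: A = chains_between [set s] (lower_set K f s).
  apply/setP => C; apply/setDP/idP => [[/XE[C0 [C' C'L CC']] CA]|CL].
    have [sC' C'K ch] := chains_betweenP _ _ _ C'L.
    apply/chains_betweenP; split; [|exact: subset_trans C'K|exact: is_chainS ch].
    (* A simplex of the closed lower star that avoids s spans with s a face of [C'], so it belongs
       to the lower link. *)
    rewrite sub1set; apply: contraR CA => sC; apply/(lower_linkP _ sK).
    have C'S : C' \in S.
      apply/order_complexP; split=> //.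
        by apply/set0Pn; exists s; rewrite -sub1set.
      by apply/subsetP => t /(subsetP C'K); rewrite inE => /andP[].
    split=> //; first exact: order_complex_faces CC' C0.
      apply: order_complex_faces C'S _ _; first by rewrite subUset sC' CC'.
      by apply/set0Pn; exists s; rewrite setU11.
    by move=> t /(subsetP CC')/(subsetP C'K); rewrite inE => /andP[].
  have [sC _ _] := chains_betweenP _ _ _ CL; rewrite sub1set in sC.
  split; last by apply/negP => /(lower_linkP _ sK)[_]; rewrite sC.
  by apply/XE; split; [apply/set0Pn; exists s|exists C].
apply: betti_eq0 => //.
- by rewrite inE eqxx.
- move=> C1 C2 /XE[_ [C' C'L CC']] C21 C20; apply/XE; split=> //.
  by exists C' => //; apply: subset_trans CC'.
- move=> C1 C2 /(lower_linkP _ sK)[CS sC sCS le] C21 C20.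
  apply/(lower_linkP _ sK); split.
  + exact: order_complex_faces C21 C20.
  + by apply: contra sC; apply/subsetP.
  + apply: order_complex_faces sCS _ _; first exact: setUS.
    by apply/set0Pn; exists s; rewrite setU11.
  + by move=> t /(subsetP C21); apply: le.
Qed.

Lemma indicator_inj : injective p.
Proof.
move=> s t /rowP st; apply/setP => i; have := st i; rewrite !mxE => /eqP.
by case: (i \in s) (i \in t) => [] []; rewrite ?eqxx ?oner_eq0 // eq_sym oner_eq0.
Qed.

Lemma realization_indicator s : s \in K -> realization S p (p s).
Proof.
move=> sK; exists [set s]; first by rewrite order_complex_set1.
exists (fun t => (t == s)%:R); first exact/barycentric_weights_vertex/set11.
by rewrite sum_vertex ?set11.
Qed.

(** * Matching critical points with critical simplices *)

Hypotheses (f_morse : discrete_morse K f) (f_inj : {in K &, injective f}).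

(** A critical s has nonzero homology in degree [#|s| - 1] only, and any other s in no degree, so a
    vertex counts for the dimension of its simplex or not at all. *)
Lemma critical_pointsE i :
  critical_points F S p g i = [set p s | s in [set` critical_simplices K f i]]%classic.
Proof.
apply/seteqP; split=> x /=.
  move=> [_ [s [sS -> b0]]]; rewrite order_complex_set1 in sS.
  exists s => //=; apply: contraNT b0 => nc.
  apply/eqP/(betti_lower_star _ sS)/(acyclic_lower_set _ K_complex f_morse f_inj _ sS).
  by move=> -[cr e]; move: nc; rewrite inE sS e eqxx /= -/(critical K f s) cr.
move=> [s /=]; rewrite inE => /and4P[sK /eqP si up lo] <-.
split; first exact: realization_indicator.
exists s; split=> //; first by rewrite order_complex_set1.
apply/eqP => /(betti_lower_star _ sK).
move=> /(acyclic_lower_set _ K_complex f_morse f_inj _ sK); apply.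
by rewrite /critical up lo.
Qed.

Lemma card_critical_points i :
  #|` fset_set (critical_points F S p g i)| = #|critical_simplices K f i|.
Proof.
have -> : fset_set (critical_points F S p g i) =
    [fset p s | s in critical_simplices K f i]%fset.
  apply/fsetP => x; rewrite in_fset_set; last exact: finite_critical_points.
  rewrite critical_pointsE; apply/idP/imfsetP => [/set_mem[s sC <-]|[s sC ->]].
    by exists s.
  by apply/mem_set; exists s.
by rewrite card_imfset /=; [rewrite cardE|exact: indicator_inj].
Qed.

(** Elements of s are removed one at a time; such flags bound the dimension of the order complex
    from below. *)
Lemma full_flag s : exists2 C : {set {set 'I_n}},
  #|C| = #|s| & is_chain C /\ {in C, forall t, t \subset s /\ t != set0}.
Proof.
have [m] := ubnP #|s|; elim: m s => // m IH s sm.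
have [->|[v vs]] := set_0Vmem s.
  exists set0; rewrite ?cards0 //; split; last by move=> t; rewrite inE.
  by apply/is_chainP => t r; rewrite inE.
have sc : #|s| = #|s :\ v|.+1 by rewrite (cardsD1 v) vs.
have [|C Cc [ch CP]] := IH (s :\ v); first by move: sm; rewrite sc.
have sC : s \notin C.
  by apply/negP => /CP[]; rewrite subsetD1 vs andbF.
exists (s |: C); first by rewrite cardsU1 sC Cc sc.
have sub t : t \in C -> t \subset s.
  by move=> /CP[ts _]; apply: subset_trans ts (subsetDl _ _).
split; first by apply: is_chainU1 => // t /sub ts; rewrite /nested ts orbT.
move=> t /setU1P[->|tC]; first by split=> //; apply/set0Pn; exists v.
by split; [exact: sub|have [] := CP _ tC].
Qed.

(* The cardinality is injective on a chain. *)
Lemma card_chain C m : is_chain C -> {in C, forall s, (0 < #|s| <= m)%N} ->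
  (#|C| <= m)%N.
Proof.
move=> /is_chainP ch Cm.
(* Cardinalities run from 1 to m, hence the shift by one; [m.-1.+1] is m once C has a member. *)
have inj : {in C &, injective (fun s => inord #|s|.-1 : 'I_m.-1.+1)}.
  move=> s t sC tC /(congr1 val) /=.
  have /andP[s0 sm] := Cm _ sC; have /andP[t0 tm] := Cm _ tC.
  have mE : m.-1.+1 = m by rewrite prednK // (leq_trans s0).
  rewrite !inordK ?mE ?prednK // => e.
  have {}e : #|s| = #|t| by rewrite -(prednK s0) e prednK.
  by have /orP[st|st] := ch _ _ sC tC; apply/eqP; [|rewrite eq_sym];
    rewrite eqEcard st e leqnn.
have [->|[s sC]] := set_0Vmem C; first by rewrite cards0.
rewrite -(card_in_imset inj) (leq_trans (max_card _)) // card_ord prednK //.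
by have /andP[s0 sm] := Cm _ sC; apply: leq_trans sm.
Qed.

(** This makes the two Morse vectors equally long. *)
Lemma dimension_order_complex : dimension S = dimension K.
Proof.
congr predn; apply/eqP; rewrite eqn_leq; apply/andP; split; apply/bigmax_leqP.
  move=> C /order_complexP[_ CK ch]; apply: card_chain => // s /(subsetP CK) sK.
  rewrite card_gt0 (leq_bigmax_cond _ sK) andbT.
  by apply: contraNneq K0 => <-.
move=> s sK; have [C Cc [ch CP]] := full_flag s.
have s0 : s != set0 by apply: contraNneq K0 => <-.
rewrite -Cc; apply: leq_bigmax_cond; apply/order_complexP; split=> //.
  by rewrite -card_gt0 Cc card_gt0.
apply/subsetP => t /CP[ts t0]; have [_ KF _] := K_complex; exact: KF sK ts t0.
Qed.

End LovaszCritical.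

Theorem theorem4p13 (R : realType) (F : fieldType) (n : nat)
    (K : {set {set 'I_n}}) (f : {set 'I_n} -> R)
    (K_complex : simplicial_complex K)
    (K_neq_powerset : K <> powerset [set: 'I_n])
    (f_morse : discrete_morse K f)
    (f_inj : {in K &, injective f}) :
  discrete_morse_vector K f =
  continuous_morse_vector F (order_complex K) (@indicator R n) (lovasz K f).
Proof.
rewrite /discrete_morse_vector /continuous_morse_vector dimension_order_complex //.
by apply: eq_mkseq => i; rewrite card_critical_points.
Qed.
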